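(* Let $(M^n,g)$ be a Riemannian manifold and fix $m\in\mathbb{R}\cup\{\pm\infty\}$ and positive functions $u,v\in C^\infty(M)$. Then, for constants $\lambda,\mu\in\mathbb{R}$, the following are equivalent: 1. $(M^n,g,v^m\,\mathrm{dvol}_g)$ is a smooth metric measure space with characteristic constant $\mu$ such that $u$ is a quasi-Einstein scale with quasi-Einstein constant $\lambda$. 2. $(M^n,\hat g,\hat v^m\,\mathrm{dvol}_{\hat g})$ is a quasi-Einstein smooth metric measure space with quasi-Einstein constant $\lambda$ and characteristic constant $\mu$, where $\hat g=u^{-2}g$ and $\hat v=v/u$. 3. $(M^n,g,u^{2-m-n}\,\mathrm{dvol}_g)$ is a smooth metric measure space (with dimensional parameter $2-m-n$) with characteristic constant $\lambda$ such that $v$ is a quasi-Einstein scale with quasi-Einstein constant $\mu$. 4. $(M^n,\tilde g,\tilde u^{2-m-n}\,\mathrm{dvol}_{\tilde g})$ is a quasi-Einstein smooth metric measure space (with dimensional parameter $2-m-n$) with quasi-Einstein constant $\mu$ and characteristic constant $\lambda$, where $\tilde g=v^{-2}g$ and $\tilde u=u/v$.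
   Context: A smooth metric measure space (SMMS) is a four-tuple $(M^n,g,v^m\,\mathrm{dvol}_g,m)$ of a Riemannian manifold, a positive function $v\in C^\infty(M)$ and a dimensional parameter $m\in\mathbb{R}\cup\{\pm\infty\}$. For finite $m$ one writes $v^m=e^{-\phi}$ (for $m=0$ the measure is $\mathrm{dvol}_g$); when $|m|=\infty$ the datum is a function $\phi\in C^\infty(M)$ and $v^{\pm\infty}$ denotes $e^{-\phi}$. Set $\mathrm{Ric}_\phi^m=\mathrm{Ric}-mv^{-1}\nabla^2v=\mathrm{Ric}+\nabla^2\phi-\frac1m d\phi\otimes d\phi$ and $R_\phi^m=R-2mv^{-1}\Delta v-m(m-1)v^{-2}|\nabla v|^2=R+2\Delta\phi-\frac{m+1}{m}|\nabla\phi|^2$; for $|m|=\infty$ the expressions in $\phi$ are used with $\frac1m=0$. The SMMS is quasi-Einstein with quasi-Einstein constant $\lambda$ if $\mathrm{Ric}_\phi^m=\lambda g$. Its characteristic constant is, for finite $m$, the constant $\mu$ such that $R_\phi^m+m\mu v^{-2}=(m+n)\lambda$; for $|m|=\infty$ it is $\mu=\lambda$. ''A SMMS with characteristic constant $\mu$'' means a SMMS together with a fixed choice of a real number $\mu$. For such a SMMS $(M,g,v^m\mathrm{dvol}_g)$, a positive function $u\in C^\infty(M)$ is a quasi-Einstein scale with quasi-Einstein constant $\lambda$ if the SMMS $(M,u^{-2}g,u^{-m-n}v^m\mathrm{dvol}_g)=(M,u^{-2}g,(v/u)^m\mathrm{dvol}_{u^{-2}g})$, with the same dimensional parameter, is quasi-Einstein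 with quasi-Einstein constant $\lambda$ and characteristic constant $\mu$. Convention for $|m|=\infty$: $u$ and $v$ are replaced by functions $f,\phi$ through the formal relations $u^{m+n-2}=e^f$, $v^m=e^{-\phi}$; then $g,\hat g,\tilde g$ coincide, a change of scale by $u$ (in 1) or $v$ (in 3) multiplies the measure by $e^{-f}$ or $e^{-\phi}$ respectively, and the measures in 2 and 4 are both $e^{-f-\phi}\mathrm{dvol}_g$.
   Formalization: When the dimensional parameter (m or 2-m-n) is 0, the formula for the characteristic constant does not involve μ and the claim fails; there the characteristic constant of (M,g,v) is instead defined by λv²+vΔv−|∇v|²=μ. *)

(* Defs.v *)
From mathcomp Require Import all_boot all_order all_algebra.
From mathcomp Require Import all_classical all_reals all_analysis.

Set Implicit Arguments.
Unset Strict Implicit.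
Unset Printing Implicit Defensive.
Import Order.TTheory GRing.Theory Num.Theory.
Import numFieldNormedType.Exports.
Local Open Scope classical_set_scope.
Local Open Scope ring_scope.

(** * Calculus in R^n *)

Definition partial (R : realType) (n : nat) (i : 'I_n) (f : 'rV[R]_n -> R) :
    'rV[R]_n -> R :=
  'D_(delta_mx 0 i) f.

Fixpoint Ck_on (R : realType) (n k : nat) (U : set 'rV[R]_n)
    (f : 'rV[R]_n -> R) : Prop :=
  (forall x, U x -> {for x, continuous f}) /\
  match k with
  | 0%N => True
  | k'.+1 => forall i : 'I_n,
      (forall x, U x -> derivable f x (delta_mx 0 i)) /\
      Ck_on k' U (partial i f)
  end.

(* C^infinity on [U], which is always open in what follows *)
Definition smooth_on (R : realType) (n : nat) (U : set 'rV[R]_n)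
    (f : 'rV[R]_n -> R) : Prop :=
  forall k, Ck_on k U f.

(** * Smooth manifolds *)

(* A manifold is given by a (not necessarily maximal) smooth atlas.  Chart [c]
   has domain [chart_dom c]; [chart_inv c] is inverse to [chart_map c] on the
   image of that domain and is arbitrary elsewhere. *)
Record smooth_manifold (R : realType) (n : nat) := SmoothManifold {
  carrier :> topologicalType;
  carrier_hausdorff : hausdorff_space carrier;
  carrier_second_countable : @second_countable carrier;
  chart : Type;
  chart_dom : chart -> set carrier;
  chart_map : chart -> carrier -> 'rV[R]_n;
  chart_inv : chart -> 'rV[R]_n -> carrier;
  chart_dom_open : forall c, open (chart_dom c);
  chart_cover : forall p, exists c, chart_dom c p;
  chart_image_open : forall c, open (chart_map c @` chart_dom c);
  chart_mapK : forall c p, chart_dom c p -> chart_inv c (chart_map c p) = p;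
  chart_map_continuous : forall c,
    {within chart_dom c, continuous (chart_map c)};
  chart_inv_continuous : forall c,
    {within chart_map c @` chart_dom c, continuous (chart_inv c)};
  chart_transition_smooth : forall c d (i : 'I_n),
    smooth_on (chart_map c @` (chart_dom c `&` chart_dom d))
      (fun x => chart_map d (chart_inv c x) 0 i)
}.

Definition chart_image (R : realType) (n : nat) (M : smooth_manifold R n)
    (c : chart M) : set 'rV[R]_n :=
  chart_map c @` chart_dom c.

Definition transition (R : realType) (n : nat) (M : smooth_manifold R n)
    (c d : chart M) : 'rV[R]_n -> 'rV[R]_n :=
  chart_map d \o chart_inv c.

Definition smooth_function (R : realType) (n : nat) (M : smooth_manifold R n)
    (f : M -> R) : Prop :=
  forall c : chart M, smooth_on (chart_image c) (f \o chart_inv c).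

(* A covariant 2-tensor field, as its matrix of components in every chart of
   the atlas, written in the coordinates of that chart; the values outside
   [chart_image c] are irrelevant. *)
Definition tensor2 (R : realType) (n : nat) (M : smooth_manifold R n) : Type :=
  chart M -> 'rV[R]_n -> 'M[R]_n.

(* The third clause is the transformation law of covariant 2-tensors: vectors
   are rows, so ['J f x] has entry d f_b / d x_a in row a and column b. *)
Definition riemannian_metric (R : realType) (n : nat)
    (M : smooth_manifold R n) (g : tensor2 M) : Prop :=
  [/\ forall (c : chart M) (i j : 'I_n),
        smooth_on (chart_image c) (fun x => g c x i j),
      forall (c : chart M) x, chart_image c x -> (g c x)^T = g c x,
      forall (c d : chart M) x,
        (chart_map c @` (chart_dom c `&` chart_dom d)) x ->
        let J := 'J (transition c d) x in
        g c x = J *m g d (transition c d x) *m J^T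
    & forall (c : chart M) x (w : 'rV[R]_n), chart_image c x -> w != 0 ->
        0 < (w *m g c x *m w^T) 0 0].

(** * Curvature and Hessian, in coordinates

   [G] is the matrix of components of a metric in a chart and [f] the
   coordinate expression of a function. *)

(* Gamma^k_ij *)
Definition christoffel (R : realType) (n : nat) (G : 'rV[R]_n -> 'M[R]_n)
    (k i j : 'I_n) (x : 'rV[R]_n) : R :=
  2^-1 * \sum_l invmx (G x) k l *
    (partial i (fun y => G y j l) x + partial j (fun y => G y i l) x
     - partial l (fun y => G y i j) x).

(* R(d_i, d_j) d_k = \sum_l (riemann l k i j) d_l, with
   R(X, Y) Z = D_X D_Y Z - D_Y D_X Z - D_[X,Y] Z *)
Definition riemann (R : realType) (n : nat) (G : 'rV[R]_n -> 'M[R]_n)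
    (l k i j : 'I_n) (x : 'rV[R]_n) : R :=
  partial i (christoffel G l j k) x - partial j (christoffel G l i k) x
  + \sum_p (christoffel G l i p x * christoffel G p j k x
            - christoffel G l j p x * christoffel G p i k x).

(* positive on round spheres *)
Definition ricci (R : realType) (n : nat) (G : 'rV[R]_n -> 'M[R]_n)
    (x : 'rV[R]_n) : 'M[R]_n :=
  \matrix_(j, k) \sum_i riemann G i k i j x.

Definition hessian (R : realType) (n : nat) (G : 'rV[R]_n -> 'M[R]_n)
    (f : 'rV[R]_n -> R) (x : 'rV[R]_n) : 'M[R]_n :=
  \matrix_(i, j) (partial i (partial j f) x
                  - \sum_k christoffel G k i j x * partial k f x).

Definition metric_trace (R : realType) (n : nat) (G : 'rV[R]_n -> 'M[R]_n)
    (T : 'rV[R]_n -> 'M[R]_n) (x : 'rV[R]_n) : R :=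
  \sum_i \sum_j invmx (G x) i j * T x i j.

Definition scalar_curvature (R : realType) (n : nat)
    (G : 'rV[R]_n -> 'M[R]_n) : 'rV[R]_n -> R :=
  metric_trace G (ricci G).

(* the nonpositive Laplacian, i.e. the trace of the Hessian *)
Definition laplacian (R : realType) (n : nat) (G : 'rV[R]_n -> 'M[R]_n)
    (f : 'rV[R]_n -> R) : 'rV[R]_n -> R :=
  metric_trace G (hessian G f).

Definition grad_norm2 (R : realType) (n : nat) (G : 'rV[R]_n -> 'M[R]_n)
    (f : 'rV[R]_n -> R) : 'rV[R]_n -> R :=
  metric_trace G (fun x => \matrix_(i, j) (partial i f x * partial j f x)).

(** * Smooth metric measure spaces *)

(* A weight for the dimensional parameter [m] is the positive function v when
   [m] is finite and the function phi, formally v^m = e^(-phi), when [m] is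
   infinite.  In the same way the scale u is replaced by f when [m] is
   infinite, formally u^(m+n-2) = e^f. *)
Definition weight_function (R : realType) (n : nat) (M : smooth_manifold R n)
    (m : \bar R) (w : M -> R) : Prop :=
  smooth_function w /\ (m \is a fin_num -> forall p, 0 < w p).

(* The measure v^m dvol_g, or e^(-phi) dvol_g, is determined by the fields. *)
Record smms (R : realType) (n : nat) (M : smooth_manifold R n) := SMMS {
  smms_metric : tensor2 M;
  smms_weight : M -> R;
  smms_dim : \bar R
}.

Definition is_smms (R : realType) (n : nat) (M : smooth_manifold R n)
    (S : smms M) : Prop :=
  riemannian_metric (smms_metric S) /\
  weight_function (smms_dim S) (smms_weight S).

(* Ric_phi^m *)
Definition weighted_ricci (R : realType) (n : nat) (M : smooth_manifold R n)
    (S : smms M) (c : chart M) (x : 'rV[R]_n) : 'M[R]_n :=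
  let G := smms_metric S c in
  let w := smms_weight S \o chart_inv c in
  match smms_dim S with
  | m%:E => ricci G x - (m / w x) *: hessian G w x
  | _ => ricci G x + hessian G w x
  end.

(* R_phi^m *)
Definition weighted_scalar (R : realType) (n : nat) (M : smooth_manifold R n)
    (S : smms M) (c : chart M) (x : 'rV[R]_n) : R :=
  let G := smms_metric S c in
  let w := smms_weight S \o chart_inv c in
  match smms_dim S with
  | m%:E => scalar_curvature G x - 2 * m / w x * laplacian G w x
            - m * (m - 1) / w x ^+ 2 * grad_norm2 G w x
  | _ => scalar_curvature G x + 2 * laplacian G w x - grad_norm2 G w x
  end.

Definition quasi_einstein (R : realType) (n : nat) (M : smooth_manifold R n)
    (S : smms M) (lambda : R) : Prop :=
  forall (c : chart M) x, chart_image c x ->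
    weighted_ricci S c x = lambda *: smms_metric S c x.

(* [mu] is the characteristic constant of [S], a quasi-Einstein space with
   constant [lambda].  For finite m <> 0 this is the identity
     R_phi^m + m mu v^-2 = (m + n) lambda.
   By the trace of Ric_phi^m = lambda g the same identity reads
     m (lambda v^2 + v Lap v + (m - 1) |grad v|^2 - mu) = 0,
   so that it does not determine mu when m = 0; in that case mu is determined
   by the vanishing of the second factor, as for every other finite m. *)
Definition characteristic_constant (R : realType) (n : nat)
    (M : smooth_manifold R n) (S : smms M) (lambda mu : R) : Prop :=
  match smms_dim S with
  | m%:E => forall (c : chart M) x, chart_image c x ->
      let G := smms_metric S c in
      let v := smms_weight S \o chart_inv c in
      if m == 0 then
        lambda * v x ^+ 2 + v x * laplacian G v x - grad_norm2 G v x = mu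
      else
        weighted_scalar S c x + m * mu / v x ^+ 2 = (m + n%:R) * lambda
  | _ => mu = lambda
  end.

Definition quasi_einstein_smms (R : realType) (n : nat)
    (M : smooth_manifold R n) (S : smms M) (lambda mu : R) : Prop :=
  [/\ is_smms S, quasi_einstein S lambda
    & characteristic_constant S lambda mu].

(** * Change of scale *)

(* u^-2 g; for infinite [m] the metric does not change *)
Definition rescaled_metric (R : realType) (n : nat) (M : smooth_manifold R n)
    (m : \bar R) (u : M -> R) (g : tensor2 M) : tensor2 M :=
  match m with
  | _%:E => fun c x => (u (chart_inv c x) ^- 2) *: g c x
  | _ => g
  end.

(* v / u; for infinite [m] the measure is multiplied by e^(-f), that is, f is
   added to phi *)
Definition rescaled_weight (R : realType) (n : nat) (M : smooth_manifold R n)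
    (m : \bar R) (u v : M -> R) : M -> R :=
  match m with
  | _%:E => fun p => v p / u p
  | _ => fun p => u p + v p
  end.

Definition rescale (R : realType) (n : nat) (M : smooth_manifold R n)
    (u : M -> R) (S : smms M) : smms M :=
  SMMS (rescaled_metric (smms_dim S) u (smms_metric S))
       (rescaled_weight (smms_dim S) u (smms_weight S)) (smms_dim S).

(* [u] is a quasi-Einstein scale, with quasi-Einstein constant [lambda], for
   the smooth metric measure space [S] with characteristic constant [mu]
   (an arbitrary real number fixed together with [S]). *)
Definition quasi_einstein_scale (R : realType) (n : nat)
    (M : smooth_manifold R n) (S : smms M) (mu : R) (u : M -> R)
    (lambda : R) : Prop :=
  weight_function (smms_dim S) u /\
  quasi_einstein_smms (rescale u S) lambda mu.

(* Main.v *)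
(** Conditions 1 and 3 are unfoldings of 2 and 4.  For infinite [m] conditions
    2 and 4 coincide, because then mu = lambda.  For finite [m] put f = v/u;
    then gtilde = f^-2 ghat and utilde = 1/f, so that 2 and 4 are exchanged by
    the involution
      (g, v, m, lambda, mu) |-> (v^-2 g, 1/v, 2 - m - n, mu, lambda).
    This involution preserves the quasi-Einstein condition: with
    h = v^-2 g one has
      Ric_h = Ric + (n-2) v^-1 Hess v + (v^-1 Lap v - (n-1) v^-2 |dv|^2) g,
      Hess_h (1/v) = - v^-2 Hess v + v^-3 |dv|^2 g,
    so the new weighted Ricci tensor is
      Ric - m v^-1 Hess v + (v^-1 Lap v + (m-1) v^-2 |dv|^2) g,
    and the characteristic constant equation
      lambda v^2 + v Lap v + (m-1) |dv|^2 = mu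
    turns this into mu v^-2 g.  *)
Require Import Defs.
From mathcomp Require Import all_boot all_order all_algebra.
From mathcomp Require Import all_classical all_reals all_analysis.
From mathcomp Require Import ring.

Set Implicit Arguments.
Unset Strict Implicit.
Unset Printing Implicit Defensive.
Import Order.TTheory GRing.Theory Num.Theory.
Import numFieldNormedType.Exports.
Local Open Scope classical_set_scope.
Local Open Scope ring_scope.

(** * Smooth functions on an open set *)

Section SmoothOn.
Variables (R : realType) (n : nat) (U : set 'rV[R]_n).
Hypothesis openU : open U.
Implicit Types (f g : 'rV[R]_n -> R) (i : 'I_n) (x : 'rV[R]_n).

Lemma near_eq_open f g x :
  (forall y, U y -> f y = g y) -> U x -> \forall y \near x, f y = g y.
Proof.
by move=> fg Ux; apply: filterS (open_nbhs_nbhs (conj openU Ux)) => y; apply: fg.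
Qed.

Lemma partial_eq i f g x :
  (forall y, U y -> f y = g y) -> U x -> partial i f x = partial i g x.
Proof. by move=> fg Ux; apply: near_eq_derive; exact: near_eq_open fg Ux. Qed.

Lemma Ck_onW k f : Ck_on k.+1 U f -> Ck_on k U f.
Proof.
elim: k f => [|k IH] f [fc fd]; split => // i.
by have [? ?] := fd i; split => //; apply: IH.
Qed.

(** As [U] is open, continuity and derivatives at a point of [U] depend only on values in [U]. The
    closure proofs below use this to replace a derivative by its formula, which is valid only on
    [U]. *)
Lemma Ck_on_eq k f g : (forall x, U x -> f x = g x) -> Ck_on k U f -> Ck_on k U g.
Proof.
have cont_eq f' g' : (forall y, U y -> f' y = g' y) ->
    (forall x, U x -> {for x, continuous f'}) ->
    forall x, U x -> {for x, continuous g'}.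
  move=> fg fc x Ux; rewrite /prop_for /continuous_at -(fg _ Ux).
  exact: cvg_trans (near_eq_cvg (near_eq_open fg Ux)) (fc _ Ux).
elim: k f g => [|k IH] f g fg [fc fd]; split => //; try exact: cont_eq fg fc.
move=> i; have [fi Cfi] := fd i; split.
  by move=> x Ux; exact: near_eq_derivable (near_eq_open fg Ux) (fi _ Ux).
by apply: IH Cfi => x Ux; exact: partial_eq.
Qed.

Lemma Ck_on_cst k (a : R) : Ck_on k U (fun=> a).
Proof.
elim: k a => [|k IH] a; split => //; try by move=> x _; exact: cst_continuous.
move=> i; split; first by move=> x _; exact: derivable_cst.
apply: Ck_on_eq (IH 0) => x _; by rewrite /partial derive_cst.
Qed.

Lemma Ck_onD k f g : Ck_on k U f -> Ck_on k U g -> Ck_on k U (fun x => f x + g x).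
Proof.
elim: k f g => [|k IH] f g [fc fd] [gc gd]; split => //;
  try by move=> x Ux; apply: continuousD; [exact: fc | exact: gc].
move=> i; have [fi Cf] := fd i; have [gi Cg] := gd i; split.
  by move=> x Ux; apply: derivableD; [exact: fi | exact: gi].
apply: Ck_on_eq (IH _ _ Cf Cg) => x Ux.
by rewrite /partial (deriveD (fi _ Ux) (gi _ Ux)).
Qed.

Lemma Ck_onM k f g : Ck_on k U f -> Ck_on k U g -> Ck_on k U (fun x => f x * g x).
Proof.
elim: k f g => [|k IH] f g Cf Cg; have [fc fd] := Cf; have [gc gd] := Cg;
  split => //; try by move=> x Ux; apply: continuousM; [exact: fc | exact: gc].
move=> i; have [fi Cif] := fd i; have [gi Cig] := gd i; split.
  by move=> x Ux; apply: derivableM; [exact: fi | exact: gi].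
apply: Ck_on_eq (Ck_onD (IH _ _ (Ck_onW Cf) Cig) (IH _ _ (Ck_onW Cg) Cif)) => x Ux.
by rewrite /partial (deriveM (fi _ Ux) (gi _ Ux)).
Qed.

Lemma Ck_onV k f : (forall x, U x -> f x != 0) -> Ck_on k U f ->
  Ck_on k U (fun x => (f x)^-1).
Proof.
move=> f0; elim: k => [|k IH] Cf; have [fc fd] := Cf;
  split => //; try by move=> x Ux; apply: continuousV; [exact: f0 | exact: fc].
move=> i; have [fi Cif] := fd i; split.
  by move=> x Ux; apply: derivableV; [exact: f0 | exact: fi].
have IHf := IH (Ck_onW Cf).
(* The derivative of 1/f is -1 times (1/f) (1/f) f', a product of functions of class [k]: the
   factors 1/f by induction, f' by hypothesis. *)
apply: Ck_on_eq (Ck_onM (Ck_on_cst k (-1)) (Ck_onM (Ck_onM IHf IHf) Cif)) => x Ux.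
rewrite /partial (deriveV (f0 _ Ux) (fi _ Ux)) /GRing.scale /=.
by rewrite mulN1r mulNr expr2 invfM.
Qed.

Lemma smooth_continuous f x : smooth_on U f -> U x -> {for x, continuous f}.
Proof. by move=> /(_ 0%N) [fc _] /fc. Qed.

Lemma smooth_derivable i f x : smooth_on U f -> U x -> derivable f x (delta_mx 0 i).
Proof. by move=> /(_ 1%N) [_ /(_ i) [fd _]] /fd. Qed.

Lemma smooth_partial i f : smooth_on U f -> smooth_on U (partial i f).
Proof. by move=> sf k; have [_ /(_ i) []] := sf k.+1. Qed.

Lemma smooth_eq f g : (forall x, U x -> f x = g x) -> smooth_on U f -> smooth_on U g.
Proof. by move=> fg sf k; apply: Ck_on_eq (sf k). Qed.

Lemma smooth_cst (a : R) : smooth_on U (fun=> a).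
Proof. by move=> k; exact: Ck_on_cst. Qed.

Lemma smoothD f g : smooth_on U f -> smooth_on U g -> smooth_on U (fun x => f x + g x).
Proof. by move=> sf sg k; apply: Ck_onD. Qed.

Lemma smoothM f g : smooth_on U f -> smooth_on U g -> smooth_on U (fun x => f x * g x).
Proof. by move=> sf sg k; apply: Ck_onM. Qed.

Lemma smoothV f : (forall x, U x -> f x != 0) -> smooth_on U f ->
  smooth_on U (fun x => (f x)^-1).
Proof. by move=> f0 sf k; apply: Ck_onV. Qed.

Lemma smoothN f : smooth_on U f -> smooth_on U (fun x => - f x).
Proof.
move=> sf; apply: smooth_eq (smoothM (smooth_cst (-1)) sf) => x _.
by rewrite mulN1r.
Qed.

Lemma smoothB f g : smooth_on U f -> smooth_on U g -> smooth_on U (fun x => f x - g x).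
Proof. by move=> sf sg; apply: smoothD sf (smoothN sg). Qed.

Lemma smooth_sum (I : Type) (r : seq I) (P : pred I) (F : I -> 'rV[R]_n -> R) :
  (forall j, smooth_on U (F j)) -> smooth_on U (fun x => \sum_(j <- r | P j) F j x).
Proof.
move=> sF; elim: r => [|j r IH].
  by apply: smooth_eq (smooth_cst 0) => x _; rewrite big_nil.
case Pj: (P j); last by apply: smooth_eq IH => x _; rewrite big_cons Pj.
by apply: smooth_eq (smoothD (sF j) IH) => x _; rewrite big_cons Pj.
Qed.

Lemma smooth_prod (I : Type) (r : seq I) (P : pred I) (F : I -> 'rV[R]_n -> R) :
  (forall j, smooth_on U (F j)) -> smooth_on U (fun x => \prod_(j <- r | P j) F j x).
Proof.
move=> sF; elim: r => [|j r IH].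
  by apply: smooth_eq (smooth_cst 1) => x _; rewrite big_nil.
case Pj: (P j); last by apply: smooth_eq IH => x _; rewrite big_cons Pj.
by apply: smooth_eq (smoothM (sF j) IH) => x _; rewrite big_cons Pj.
Qed.

Lemma smooth_det p (A : 'rV[R]_n -> 'M[R]_p) :
  (forall (a b : 'I_p), smooth_on U (fun x => A x a b)) ->
  smooth_on U (fun x => \det (A x)).
Proof.
move=> sA; apply: smooth_sum => s; apply: smoothM; first exact: smooth_cst.
by apply: smooth_prod.
Qed.

(** Cramer's rule: an entry of the inverse is a cofactor divided by the determinant, and both are
    polynomials in the entries. *)
Lemma smooth_invmx p (A : 'rV[R]_n -> 'M[R]_p) :
  (forall x, U x -> A x \in unitmx) ->
  (forall (a b : 'I_p), smooth_on U (fun x => A x a b)) ->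
  forall (a b : 'I_p), smooth_on U (fun x => invmx (A x) a b).
Proof.
move=> uA sA a b.
have sC : smooth_on U (fun x => cofactor (A x) b a).
  apply: smoothM; first exact: smooth_cst.
  apply: smooth_det => k l.
  by apply: smooth_eq (sA (lift b k) (lift a l)) => x _; rewrite !mxE.
have sdet : smooth_on U (fun x => (\det (A x))^-1).
  by apply: smoothV; [move=> x /uA; rewrite unitmxE unitfE | exact: smooth_det].
by apply: smooth_eq (smoothM sdet sC) => x Ux; rewrite /invmx uA // !mxE.
Qed.

Lemma smooth_christoffel (G : 'rV[R]_n -> 'M[R]_n) :
  (forall x, U x -> G x \in unitmx) ->
  (forall i j, smooth_on U (fun x => G x i j)) ->
  forall k i j, smooth_on U (christoffel G k i j).
Proof.
move=> uG sG k i j.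
rewrite /christoffel.
apply: smooth_eq (smoothM (smooth_cst 2^-1) (smooth_sum
   (index_enum 'I_n) xpredT (F := fun l x => invmx (G x) k l *
    (partial i (fun y => G y j l) x + partial j (fun y => G y i l) x
     - partial l (fun y => G y i j) x)) _)).
  by move=> x _; rewrite mulr_sumr; apply: eq_bigr => l _; rewrite mulrA.
move=> l; apply: smoothM; first exact: smooth_invmx.
by apply: smoothB; first apply: smoothD; apply: smooth_partial; exact: sG.
Qed.

(** * Rules for partial derivatives of smooth functions at a point *)

Section PartialRules.
Variables (x : 'rV[R]_n) (i : 'I_n).
Hypothesis Ux : U x.

Lemma partial_cst (a : R) : partial i (fun=> a) x = 0.
Proof. exact: derive_cst. Qed.

Lemma partialD f g : smooth_on U f -> smooth_on U g ->
  partial i (fun y => f y + g y) x = partial i f x + partial i g x.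
Proof.
move=> sf sg; rewrite /partial.
by rewrite (deriveD (smooth_derivable (i := i) sf Ux) (smooth_derivable (i := i) sg Ux)).
Qed.

Lemma partialM f g : smooth_on U f -> smooth_on U g ->
  partial i (fun y => f y * g y) x = f x * partial i g x + g x * partial i f x.
Proof.
move=> sf sg; rewrite /partial.
by rewrite (deriveM (smooth_derivable (i := i) sf Ux) (smooth_derivable (i := i) sg Ux)).
Qed.

Lemma partialV f : f x != 0 -> smooth_on U f ->
  partial i (fun y => (f y)^-1) x = - partial i f x / f x ^+ 2.
Proof.
move=> f0 sf; rewrite {1}/partial (deriveV f0 (smooth_derivable (i := i) sf Ux)).
by rewrite /GRing.scale /= mulrC mulrN mulNr.
Qed.

Lemma partialN f : smooth_on U f -> partial i (fun y => - f y) x = - partial i f x.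
Proof. by move=> sf; rewrite /partial (deriveN (smooth_derivable (i := i) sf Ux)). Qed.

Lemma partialB f g : smooth_on U f -> smooth_on U g ->
  partial i (fun y => f y - g y) x = partial i f x - partial i g x.
Proof.
move=> sf sg; rewrite /partial.
by rewrite (deriveB (smooth_derivable (i := i) sf Ux) (smooth_derivable (i := i) sg Ux)).
Qed.

Lemma partial_sum (I : Type) (r : seq I) (F : I -> 'rV[R]_n -> R) :
  (forall j, smooth_on U (F j)) ->
  partial i (fun y => \sum_(j <- r) F j y) x = \sum_(j <- r) partial i (F j) x.
Proof.
move=> sF; elim: r => [|j r IH].
  rewrite big_nil -[RHS](partial_cst 0).
  by apply: (partial_eq _ _ Ux) => y _; rewrite big_nil.
rewrite big_cons -IH -partialD //; last exact: smooth_sum.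
by apply: (partial_eq _ _ Ux) => y _; rewrite big_cons.
Qed.

End PartialRules.
End SmoothOn.

(** * Symmetry of second derivatives *)

Section Schwarz.
Variables (R : realType) (V : normedModType R).
Implicit Types (f : V -> R) (a b v x y : V) (d : R).

(** The difference quotients of the two functions agree for every increment [h], so existence and
    value of the limit carry over. *)
Lemma is_derive_line f v y (s d : R) : is_derive (s *: v + y) v f d ->
  is_derive s 1 (fun t : R => f (t *: v + y)) d.
Proof.
have E : (fun h : R => h^-1 *: (((fun t : R => f (t *: v + y)) \o shift s) (h *: 1)
            - f (s *: v + y)))
       = (fun h : R => h^-1 *: ((f \o shift (s *: v + y)) (h *: v) - f (s *: v + y))).
  apply/funext => h /=; congr (_ *: (f _ - _)).
  by rewrite scalerDl [h *: 1]mulr1 addrA.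
by move=> [df <-]; apply: DeriveDef; rewrite /derivable /derive E.
Qed.

Lemma is_derive_translate f a v y d : is_derive (a + y) v f d ->
  is_derive y v (fun z => f (a + z)) d.
Proof.
have E : (fun k : R => k^-1 *: (((fun z => f (a + z)) \o shift y) (k *: v) - f (a + y)))
       = (fun k : R => k^-1 *: ((f \o shift (a + y)) (k *: v) - f (a + y))).
  by apply/funext => k /=; rewrite addrCA.
by move=> [df <-]; apply: DeriveDef; rewrite /derivable /derive E.
Qed.

Lemma MVT_line f df v y (h : R) : 0 < h ->
  (forall s : R, 0 <= s <= h -> is_derive (s *: v + y) v f (df (s *: v + y))) ->
  exists2 s : R, 0 <= s <= h & f (h *: v + y) - f y = df (s *: v + y) * h.
Proof.
move=> h0 fdf.
have [|| s] := @MVT R (fun t : R => f (t *: v + y))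
   (fun s => df (s *: v + y)) 0 h h0.
- move=> s; rewrite in_itv /= => /andP[s0 sh].
  by apply: is_derive_line; apply: fdf; rewrite !ltW.
- apply: derivable_within_continuous => s; rewrite in_itv /= => /fdf /is_derive_line.
  by case.
- rewrite in_itv /= subr0 scale0r add0r => /andP[s0 sh] E.
  by exists s => //; rewrite !ltW.
Qed.

(** The mean value theorem is used twice: in direction [a] for the increment [f (h *: b + y) - f y],
    then in direction [b] for [fa]. *)
Lemma second_difference f fa fab a b x (h : R) : 0 < h ->
  (forall s t : R, 0 <= s <= h -> 0 <= t <= h -> let y := s *: a + t *: b + x in
     is_derive y a f (fa y) /\ is_derive y b fa (fab y)) ->
  exists s t : R, [/\ 0 <= s <= h, 0 <= t <= h &
    f (h *: a + h *: b + x) - f (h *: a + x) - f (h *: b + x) + f x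
    = fab (s *: a + t *: b + x) * h * h].
Proof.
move=> h0 df.
have h0' : 0 <= (0 : R) <= h by rewrite lexx ltW.
have hh' : 0 <= h <= h by rewrite lexx ltW.
have [|s hs Es] := @MVT_line (fun y => f (h *: b + y) - f y)
    (fun y => fa (h *: b + y) - fa y) a x h h0.
  move=> s hs; apply: is_deriveB; last first.
    by have [] := df s 0 hs h0'; rewrite scale0r addr0.
  apply: is_derive_translate; rewrite addrCA addrA.
  by have [] := df s h hs hh'.
have [|t ht Et] := @MVT_line fa fab b (s *: a + x) h h0.
  by move=> t ht; rewrite addrCA addrA; have [] := df s t hs ht.
exists s, t; split => //.
rewrite -[s *: a + t *: b + x]addrA [s *: a + (t *: b + x)]addrCA -Et -Es.
by rewrite [h *: b + (h *: a + x)]addrCA !addrA; ring.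
Qed.

Lemma derive_comm f fa fb fab fba a b x :
  (\forall y \near x, [/\ is_derive y a f (fa y), is_derive y b f (fb y),
     is_derive y b fa (fab y) & is_derive y a fb (fba y)]) ->
  {for x, continuous fab} -> {for x, continuous fba} -> fab x = fba x.
(* Both mixed derivatives, at points close to [x], are the quotient of the same
   second difference of [f] by [h^2]. *)
Proof.
move=> df cA cB; apply/eqP/negPn/negP => AB.
(* Half the gap: a common value within [e] of both [fab x] and [fba x] would make the gap smaller
   than itself. *)
pose e := `|fab x - fba x| / 2.
have e0 : 0 < e by rewrite divr_gt0 // normr_gt0 subr_eq0.
have nA : \forall y \near x, `|fab x - fab y| < e.
  by move/cvgrPdist_lt: cA; apply.
have nB : \forall y \near x, `|fba x - fba y| < e.
  by move/cvgrPdist_lt: cB; apply.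
pose P y := [/\ is_derive y a f (fa y), is_derive y b f (fb y),
     is_derive y b fa (fab y) & is_derive y a fb (fba y)] /\
    (`|fab x - fab y| < e /\ `|fba x - fba y| < e).
have nP : nbhs x P by apply: filterI df _; apply: filterI nA nB.
have [d /= d0 dP] := (nbhs_normP x P).1 nP.
(* The summand 1 keeps the denominator positive when [a] and [b] vanish, and makes every
   [s *: a + t *: b] strictly shorter than [d]. *)
pose h := d / (`|a| + `|b| + 1).
have ab0 : 0 < `|a| + `|b| + 1 by rewrite ltr_wpDl // addr_ge0.
have h0 : 0 < h by rewrite divr_gt0.
have H (s t : R) : 0 <= s <= h -> 0 <= t <= h -> P (s *: a + t *: b + x).
  move=> /andP[s0 sh] /andP[t0 th]; apply: dP => /=.
  rewrite opprD addrCA subrr addr0 normrN (le_lt_trans (ler_normD _ _)) // !normrZ.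
  rewrite !ger0_norm //; apply: (@le_lt_trans _ _ (h * `|a| + h * `|b|)).
    by rewrite lerD // ler_wpM2r.
  by rewrite -mulrDr /h mulrAC -mulrA gtr_pMr // ltr_pdivrMr // mul1r ltrDl.
have [|s [t [hs ht E1]]] := @second_difference f fa fab a b x h h0.
  by move=> s t hs ht; have [[]] := H s t hs ht.
(* The two directions are exchanged here, so the point reached is [t' *: a + s' *: b + x]. *)
have [|s' [t' [hs' ht' E2]]] := @second_difference f fb fba b a x h h0.
  by move=> s' t' hs' ht'; rewrite [s' *: b + _]addrC; have [[]] := H t' s' ht' hs'.
have [_ [L1 _]] := H _ _ hs ht.
have [_ [_ L2]] := H _ _ ht' hs'.
have E : fab (s *: a + t *: b + x) = fba (t' *: a + s' *: b + x).
  apply: (mulIf (lt0r_neq0 h0)); apply: (mulIf (lt0r_neq0 h0)).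
  by rewrite -E1 [t' *: a + _]addrC -E2 [h *: b + h *: a]addrC [RHS]addrAC; ring.
rewrite E in L1; rewrite distrC in L2.
have : `|fab x - fba x| < e + e.
  exact: le_lt_trans (ler_distD _ _ _) (ltrD L1 L2).
by rewrite /e -splitr ltxx.
Qed.

End Schwarz.

Lemma partialC (R : realType) n (U : set 'rV[R]_n) (f : 'rV[R]_n -> R) (i j : 'I_n) x :
  open U -> smooth_on U f -> U x -> partial i (partial j f) x = partial j (partial i f) x.
Proof.
move=> openU sf Ux.
apply: (@derive_comm _ _ f (partial j f) (partial i f) _ _
  (delta_mx 0 j) (delta_mx 0 i)).
- apply: filterS (open_nbhs_nbhs (conj openU Ux)) => y Uy.
  split; apply: derivableP; apply: smooth_derivable Uy => //; exact: smooth_partial.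
- by apply: smooth_continuous Ux; do 2 apply: smooth_partial.
- by apply: smooth_continuous Ux; do 2 apply: smooth_partial.
Qed.

(** * Index algebra of a conformal change *)

Lemma sum_delta (F : pzRingType) n (j : 'I_n) (f : 'I_n -> F) :
  \sum_i (i == j)%:R * f i = f j.
Proof.
rewrite (bigD1 j) //= eqxx mul1r big1 ?addr0 // => i /negbTE ->.
by rewrite mul0r.
Qed.

(** This is the shape of the divergence of [conf] below: [a] and [b] carry the product rule for the
    metric term, [c] and [d] the derivatives of [w], whose sums the Kronecker deltas collapse. *)
Lemma sum_split_delta (F : comNzRingType) n (g : F) (a b c d : 'I_n -> F) j k :
  \sum_i (g * a i + b i - ((i == k)%:R * c i + (i == j)%:R * d i))
  = g * (\sum_i a i) + \sum_i b i - (d j + c k).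
Proof.
by rewrite sumrB !big_split /= -mulr_sumr !sum_delta [c k + _]addrC.
Qed.

(** Curvature is a derivative of the connection plus a quadratic term. With [A] the old symbols and
    [B] their change, the part in [A] alone, which is the old Ricci tensor, is separated from
    everything containing [B]. *)
Lemma ricci_split (F : comNzRingType) n (A B : 'I_n -> 'I_n -> 'I_n -> F)
    (dA dB : 'I_n -> 'I_n -> 'I_n -> 'I_n -> F) j k :
  \sum_i (dA i i j k + dB i i j k - (dA j i i k + dB j i i k)
    + \sum_p ((A i i p + B i i p) * (A p j k + B p j k)
              - (A i j p + B i j p) * (A p i k + B p i k)))
  = \sum_i (dA i i j k - dA j i i k + \sum_p (A i i p * A p j k - A i j p * A p i k))
    + \sum_i dB i i j k - \sum_i dB j i i k
    + \sum_i \sum_p (A i i p * B p j k + B i i p * A p j k + B i i p * B p j k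
       - (A i j p * B p i k + B i j p * A p i k + B i j p * B p i k)).
Proof.
rewrite -big_split -sumrB -big_split /=; apply: eq_bigr => i _.
have -> : \sum_p ((A i i p + B i i p) * (A p j k + B p j k)
              - (A i j p + B i j p) * (A p i k + B p i k))
  = \sum_p (A i i p * A p j k - A i j p * A p i k)
    + \sum_p (A i i p * B p j k + B i i p * A p j k + B i i p * B p j k
       - (A i j p * B p i k + B i j p * A p i k + B i j p * B p i k)).
  by rewrite -big_split /=; apply: eq_bigr => p _; ring.
ring.
Qed.

Section ConformalAlgebra.
Variables (F : comNzRingType) (n : nat).
Variables (G H : 'I_n -> 'I_n -> F) (Gam : 'I_n -> 'I_n -> 'I_n -> F).
Variables (w : 'I_n -> F).
Hypothesis Gsym : forall i j, G i j = G j i.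
Hypothesis GH : forall i j, \sum_k G i k * H k j = (i == j)%:R.
Hypothesis Gamsym : forall k i j, Gam k i j = Gam k j i.

Definition raise (k : 'I_n) : F := \sum_l H k l * w l.

(* With [G] a metric, [H] its inverse and [w = d log v], this is the difference
   of the Christoffel symbols of [v^-2 G] and [G]. *)
Definition conf (k i j : 'I_n) : F :=
  G i j * raise k - ((k == j)%:R * w i + (k == i)%:R * w j).

Let W := raise.
Let N := \sum_k w k * W k.

Lemma lower_raise k : \sum_i G k i * W i = w k.
Proof.
under eq_bigr do rewrite mulr_sumr.
rewrite exchange_big /= -[RHS](sum_delta _ w); apply: eq_bigr => l _.
rewrite eq_sym -GH mulr_suml; apply: eq_bigr => i _.
by rewrite mulrA.
Qed.

Lemma conf_sym k i j : conf k i j = conf k j i.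
Proof. by rewrite /conf Gsym addrC [_ * w j + _]addrC addrC. Qed.

Lemma conf_contract (a : 'I_n -> F) i j :
  \sum_k a k * conf k i j = G i j * (\sum_k a k * W k) - (a j * w i + a i * w j).
Proof.
under eq_bigr do rewrite mulrBr mulrDr.
rewrite sumrB big_split /= mulr_sumr; congr (_ - (_ + _)).
- by apply: eq_bigr => k _; rewrite mulrCA.
- rewrite -[RHS]mulrC -(sum_delta j (fun k => w i * a k)); apply: eq_bigr => k _; ring.
- rewrite -[RHS]mulrC -(sum_delta i (fun k => w j * a k)); apply: eq_bigr => k _; ring.
Qed.

(** The trace of the Christoffel symbols is the logarithmic derivative of the volume density, which
    passing to v^-2 G multiplies by v^-n. Algebraically, the metric term cancels one Kronecker term
    and the other is counted n times. *)
Lemma conf_trace k : \sum_i conf i i k = - (n%:R * w k).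
Proof.
rewrite /conf sumrB big_split /= sum_delta.
have -> : \sum_(i < n) (i == i)%:R * w k = n%:R * w k.
  under eq_bigr do rewrite eqxx mul1r.
  by rewrite sumr_const card_ord mulr_natl.
have -> : \sum_i G i k * raise i = w k.
  by rewrite -lower_raise; apply: eq_bigr => i _; rewrite Gsym.
ring.
Qed.

(** Contracting with [G] turns [W] back into [w]; this cancels one Kronecker term and leaves the one
    carrying the norm [N]. *)
Lemma conf_raise i j : \sum_p conf i j p * W p = - ((i == j)%:R * N).
Proof.
have -> : \sum_p conf i j p * W p
    = W i * (\sum_p G j p * W p) - (w j * \sum_p (p == i)%:R * W p
        + (i == j)%:R * \sum_p w p * W p).
  rewrite !mulr_sumr -big_split -sumrB /=; apply: eq_bigr => p _.
  rewrite /conf [p == i]eq_sym -/W; ring.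
by rewrite lower_raise sum_delta -/N; ring.
Qed.

Let trGam k := \sum_i Gam i i k.

(** The products are contracted one at a time in [E1] to [E6]. The last sum stays in terms of [Gam]
    and [G]: metric compatibility identifies it with the derivative of [G] along [W], which cancels
    against the divergence of [conf]. *)
Lemma conf_quadratic j k :
  \sum_i \sum_p (Gam i i p * conf p j k + conf i i p * Gam p j k
     + conf i i p * conf p j k
     - (Gam i j p * conf p i k + conf i j p * Gam p i k + conf i j p * conf p i k))
  = (n%:R - 2) * (w j * w k - \sum_p Gam p j k * w p)
    + G j k * (\sum_p trGam p * W p - (n%:R - 2) * N)
    - \sum_i (\sum_p Gam p i j * G p k + \sum_p Gam p i k * G j p) * W i.
Proof.
have E1 : \sum_i \sum_p Gam i i p * conf p j k =
    G j k * (\sum_p trGam p * W p) - (trGam k * w j + trGam j * w k).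
  rewrite exchange_big /= -conf_contract; apply: eq_bigr => p _.
  by rewrite mulr_suml.
have E2 : \sum_i \sum_p conf i i p * Gam p j k = - (n%:R * \sum_p Gam p j k * w p).
  rewrite exchange_big /= mulr_sumr -sumrN; apply: eq_bigr => p _.
  by rewrite -mulr_suml conf_trace; ring.
have E3 : \sum_i \sum_p conf i i p * conf p j k =
    n%:R * (w j * w k + w j * w k) - n%:R * (G j k * N).
  rewrite exchange_big /=.
  under eq_bigr do rewrite -mulr_suml conf_trace.
  rewrite conf_contract -/N.
  have -> : \sum_k0 - (n%:R * w k0) * W k0 = - (n%:R * N).
    by rewrite mulr_sumr -sumrN; apply: eq_bigr => p _; ring.
  ring.
have trS l : \sum_i Gam i l i = trGam l by apply: eq_bigr => i _.
have E4 : \sum_i \sum_p Gam i j p * conf p i k =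
    \sum_i (\sum_p Gam p i j * G p k) * W i - (\sum_p Gam p j k * w p + trGam j * w k).
  under eq_bigr do rewrite conf_contract.
  rewrite sumrB big_split /= -mulr_suml trS; congr (_ - _).
  under [RHS]eq_bigr do rewrite mulr_suml.
  rewrite [RHS]exchange_big /=; apply: eq_bigr => i _.
  by rewrite mulr_sumr; apply: eq_bigr => p _; rewrite (Gamsym i p j); ring.
have E5 : \sum_i \sum_p conf i j p * Gam p i k =
    \sum_i (\sum_p Gam p i k * G j p) * W i - (trGam k * w j + \sum_p Gam p j k * w p).
  rewrite exchange_big /=.
  under eq_bigr => p _ do under eq_bigr => i _ do rewrite mulrC.
  under eq_bigr do rewrite conf_contract.
  rewrite sumrB big_split /= -mulr_suml; congr (_ - _).
  under [RHS]eq_bigr do rewrite mulr_suml.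
  rewrite [RHS]exchange_big /=; apply: eq_bigr => i _.
  by rewrite mulr_sumr; apply: eq_bigr => p _; ring.
have E6 : \sum_i \sum_p conf i j p * conf p i k =
    (n%:R + 2) * (w j * w k) - 2 * (G j k * N).
  under eq_bigr do rewrite conf_contract conf_raise.
  rewrite sumrB big_split /= -mulr_suml.
  under [\sum_i conf i j i]eq_bigr do rewrite conf_sym.
  rewrite conf_trace.
  under [\sum_i conf i j k * _]eq_bigr do rewrite mulrC.
  rewrite conf_contract -/N.
  have -> : \sum_i G i k * - ((i == j)%:R * N) = - (G j k * N).
    rewrite -(sum_delta j (fun i => G i k * N)) -sumrN.
    by apply: eq_bigr => i _; ring.
  ring.
have -> : \sum_i (\sum_p Gam p i j * G p k + \sum_p Gam p i k * G j p) * W i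
   = \sum_i (\sum_p Gam p i j * G p k) * W i + \sum_i (\sum_p Gam p i k * G j p) * W i.
  by rewrite -big_split /=; apply: eq_bigr => i _; rewrite mulrDl.
transitivity (\sum_i \sum_p Gam i i p * conf p j k
   + \sum_i \sum_p conf i i p * Gam p j k + \sum_i \sum_p conf i i p * conf p j k
   - (\sum_i \sum_p Gam i j p * conf p i k + \sum_i \sum_p conf i j p * Gam p i k
      + \sum_i \sum_p conf i j p * conf p i k)).
  rewrite -!big_split -sumrB /=; apply: eq_bigr => i _.
  by rewrite -!big_split -sumrB.
rewrite E1 E2 E3 E4 E5 E6; ring.
Qed.

End ConformalAlgebra.

(** * The inversion in a chart *)

(** Substitutes three computed terms at once, without searching for them inside a large
    expression. *)
Lemma eq_sub4 (V : zmodType) (r a b c d b' c' d' : V) :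
  r = a + b - c + d -> b = b' -> c = c' -> d = d' -> r = a + b' - c' + d'.
Proof. by move=> -> -> -> ->. Qed.

(** The common shape of the conformal formulas for the Ricci tensor and the Hessian; it accounts for
    the leading 0 in [hessian_inversion]. *)
Lemma mx_lincomb (R : pzRingType) m n (A B D : 'M[R]_(m, n)) (c d : R) i j :
  (A + c *: B + d *: D) i j = A i j + c * B i j + d * D i j.
Proof. by rewrite !mxE. Qed.

Section MetricTrace.
Variables (R : realType) (n : nat).
Implicit Types (G T : 'rV[R]_n -> 'M[R]_n) (x : 'rV[R]_n).

(** As a matrix trace the contraction inherits linearity, and the inverse metric can be cancelled
    against the metric. *)
Lemma metric_traceE G T x : metric_trace G T x = \tr (invmx (G x) *m (T x)^T).
Proof.
rewrite /metric_trace /mxtrace; apply: eq_bigr => i _; rewrite !mxE.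
by apply: eq_bigr => j _; rewrite !mxE.
Qed.

Lemma metric_trace_self G x : G x \in unitmx -> (G x)^T = G x ->
  metric_trace G G x = n%:R.
Proof. by move=> uG sG; rewrite metric_traceE sG mulVmx // mxtrace1. Qed.

End MetricTrace.



Section Inversion.
Variables (R : realType) (n : nat) (U : set 'rV[R]_n).
Variables (G : 'rV[R]_n -> 'M[R]_n) (v : 'rV[R]_n -> R).
Hypothesis openU : open U.
Hypothesis smG : forall i j, smooth_on U (fun x => G x i j).
Hypothesis symG : forall x, U x -> (G x)^T = G x.
Hypothesis uG : forall x, U x -> G x \in unitmx.
Hypothesis smv : smooth_on U v.
Hypothesis v0 : forall x, U x -> v x != 0.
Implicit Types (i j k l p : 'I_n) (x : 'rV[R]_n).

Definition ginv x := invmx (G x).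
(** The differential of log v, as a quotient so that it makes sense for any nonvanishing [v]. *)
Definition dlog i x : R := partial i v x / v x.
Definition dlog_raised k x : R := raise (ginv x) (dlog ^~ x) k.
Definition christoffel_diff k i j x : R := conf (G x) (ginv x) (dlog ^~ x) k i j.
Definition inverted_metric x := v x ^- 2 *: G x.

Local Notation Gam := (christoffel G).
Local Notation H := ginv.
Local Notation w := dlog.
Local Notation W := dlog_raised.
Local Notation C := christoffel_diff.

Lemma smooth_ginv i j : smooth_on U (fun x => H x i j).
Proof. exact: smooth_invmx. Qed.
#[local] Hint Resolve smooth_ginv : core.

Lemma smooth_christoffel_metric k i j : smooth_on U (Gam k i j).
Proof. exact: smooth_christoffel. Qed.
#[local] Hint Resolve smooth_christoffel_metric : core.

Lemma smooth_dlog i : smooth_on U (w i).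
Proof. by apply: smoothM => //; [apply: smooth_partial | apply: smoothV]. Qed.
#[local] Hint Resolve smooth_dlog : core.

Lemma smooth_dlog_raised k : smooth_on U (W k).
Proof.
apply: smooth_sum => // l.
exact: (smoothM openU (smooth_ginv k l) (smooth_dlog l)).
Qed.
#[local] Hint Resolve smooth_dlog_raised : core.

Lemma smooth_christoffel_diff k i j : smooth_on U (C k i j).
Proof.
rewrite /christoffel_diff /conf; apply: smoothB => //.
  by refine (smoothM openU (smG i j) (smooth_dlog_raised k)).
by apply: smoothD => //; apply: smoothM => //; exact: smooth_cst.
Qed.
#[local] Hint Resolve smooth_christoffel_diff : core.

(** * Compatibility of the Christoffel symbols with the metric *)

Lemma partial_metricC i j p x : U x ->
  partial p (fun y => G y i j) x = partial p (fun y => G y j i) x.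
Proof.
by move=> Ux; apply: (partial_eq openU _ _ Ux) => y Uy; rewrite -{1}(symG Uy) mxE.
Qed.

Lemma christoffelC k i j x : U x -> Gam k i j x = Gam k j i x.
Proof.
move=> Ux; rewrite /christoffel; congr (_ * _); apply: eq_bigr => l _.
by rewrite (partial_metricC i j) //; congr (_ * _); ring.
Qed.

Lemma ginv_metric x : U x -> forall i j, \sum_k H x i k * G x k j = (i == j)%:R.
Proof.
move=> Ux i j; have /matrixP/(_ i j) := mulVmx (uG Ux).
by rewrite !mxE.
Qed.

Lemma metric_ginv x : U x -> forall i j, \sum_k G x i k * H x k j = (i == j)%:R.
Proof.
move=> Ux i j; have /matrixP/(_ i j) := mulmxV (uG Ux).
by rewrite !mxE.
Qed.

Lemma metricC x : U x -> forall i j, G x i j = G x j i.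
Proof. by move=> Ux i j; rewrite -{1}(symG Ux) mxE. Qed.

Lemma ginvC x : U x -> forall i j, H x i j = H x j i.
Proof.
move=> Ux i j; have : (H x)^T = H x by rewrite /ginv trmx_inv symG.
by move/matrixP/(_ j i); rewrite mxE.
Qed.

(** Contraction with [G] cancels the inverse metric and leaves the Christoffel symbols of the first
    kind. *)
Lemma christoffel_lower p i j x : U x ->
  \sum_l Gam l p i x * G x l j = 2^-1 * (partial p (fun y => G y i j) x
    + partial i (fun y => G y p j) x - partial j (fun y => G y p i) x).
Proof.
move=> Ux; rewrite /christoffel.
under eq_bigr do rewrite -mulrA mulr_suml.
rewrite -mulr_sumr exchange_big /=; congr (_ * _).
rewrite -[RHS](sum_delta j (fun m => partial p (fun y => G y i m) x
    + partial i (fun y => G y p m) x - partial m (fun y => G y p i) x)).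
apply: eq_bigr => m _; rewrite eq_sym -(metric_ginv Ux) mulr_suml; apply: eq_bigr => l _.
by rewrite (metricC Ux l j) (ginvC Ux l m); ring.
Qed.

(** The Levi-Civita connection preserves the metric: in the sum of the two symbols of the first kind
    only the derivative along [p] survives. *)
Lemma partial_metric p i j x : U x ->
  partial p (fun y => G y i j) x
  = \sum_l Gam l p i x * G x l j + \sum_l Gam l p j x * G x i l.
Proof.
move=> Ux; under [X in _ + X]eq_bigr do rewrite (metricC Ux).
rewrite !christoffel_lower //.
rewrite (partial_metricC j i) //.
by move: (partial p _ x) (partial i _ x) (partial j _ x) => a b c; field.
Qed.

(** Differentiating the identity H G = 1 expresses the derivative of the inverse through that of
    [G], which metric compatibility supplies. *)
Lemma partial_inverse_metric p i m x : U x ->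
  partial p (fun y => H y i m) x
  = - (\sum_l H x i l * Gam m p l x + \sum_l Gam i p l x * H x l m).
Proof.
move=> Ux.
pose dH := \matrix_(a, b) partial p (fun y => H y a b) x.
pose dG := \matrix_(a, b) partial p (fun y => G y a b) x.
pose A := \matrix_(l, k) Gam l p k x.
have EdG : dG = A^T *m G x + G x *m A.
  apply/matrixP => a b; rewrite !mxE partial_metric //; congr (_ + _).
    by apply: eq_bigr => l _; rewrite !mxE.
  by apply: eq_bigr => l _; rewrite !mxE mulrC.
have E : dH *m G x + H x *m dG = 0.
  apply/matrixP => a b; rewrite !mxE -big_split /=.
  have /(partial_eq openU p)/(_ Ux) : forall y, U y ->
      \sum_k H y a k * G y k b = (a == b)%:R by move=> y Uy; exact: ginv_metric.
  rewrite partial_cst (partial_sum openU _ Ux); last by move=> k; exact: smoothM.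
  move=> E; rewrite -[RHS]E; apply: eq_bigr => k _.
  by rewrite (partialM _ Ux) // !mxE; ring.
have {}E : dH = - (H x *m A^T + A *m H x).
  have HGx : H x *m G x = 1%:M by exact: mulVmx (uG Ux).
  have GHx : G x *m H x = 1%:M by exact: mulmxV (uG Ux).
  have := congr1 (mulmx^~ (H x)) E.
  rewrite /= mul0mx mulmxDl -[dH *m _ *m _]mulmxA GHx mulmx1 EdG mulmxDr mulmxDl.
  rewrite -!mulmxA GHx mulmx1 !mulmxA HGx mul1mx => /eqP.
  by rewrite addr_eq0 => /eqP.
have /matrixP/(_ i m) := E; rewrite !mxE => ->; congr (- (_ + _)).
  by apply: eq_bigr => l _; rewrite !mxE.
by apply: eq_bigr => l _; rewrite !mxE.
Qed.

(** * Christoffel symbols and Ricci tensor of v^-2 G *)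

Lemma inverted_metric_inv x : U x -> invmx (inverted_metric x) = v x ^+ 2 *: H x.
Proof.
move=> Ux; rewrite /inverted_metric invmxZ ?invrK //.
by rewrite unitmxZ ?uG // unitfE invr_eq0 expf_neq0 ?v0.
Qed.

Lemma partial_inverted_metric p i j x : U x ->
  partial p (fun y => inverted_metric y i j) x
  = v x ^- 2 * (partial p (fun y => G y i j) x - 2 * w p x * G x i j).
Proof.
move=> Ux; have vx := v0 Ux.
have smV : smooth_on U (fun y => (v y)^-1) by exact: smoothV.
transitivity (partial p (fun y => (v y)^-1 * (v y)^-1 * G y i j) x).
  by apply: (partial_eq openU _ _ Ux) => y _; rewrite /inverted_metric mxE expr2 invfM.
rewrite !(partialM _ Ux, partialV _ Ux) //; last exact: smoothM.
by rewrite /dlog; field.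
Qed.

Lemma christoffel_conformal k i j x : U x ->
  christoffel inverted_metric k i j x = Gam k i j x + C k i j x.
Proof.
move=> Ux; have vx := v0 Ux; rewrite /christoffel inverted_metric_inv //.
(* The Kronecker deltas of [conf] are written back as contractions of [G] with its inverse, so that
   both sides become sums over the same [l], compared term by term. *)
have -> : C k i j x = - (\sum_l (w i x * (G x j l * H x l k)
   + w j x * (G x i l * H x l k) - G x i j * (H x k l * w l x))).
  rewrite sumrB big_split /= -!mulr_sumr !(metric_ginv Ux) /christoffel_diff /conf /raise.
  rewrite [k == j]eq_sym [k == i]eq_sym.
  by move: (\sum_l _) (w i x) (w j x) (G x) => s wi wj g; ring.
rewrite /christoffel !mulr_sumr -sumrN -big_split /=.
apply: eq_bigr => l _; rewrite !partial_inverted_metric // (ginvC Ux l k) mxE -/(H x).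
move: (v x) vx (H x k l) (w i x) (w j x) (w l x) (G x) (partial i _ x) (partial j _ x)
  (partial l _ x) => z z0 hkl wi wj wl g' gi gj gl.
by field.
Qed.

(** The covariant divergence of the gradient of log v is the trace of its Hessian. Of the two terms
    from the derivative of the inverse metric, one is the trace of the symbols, the other the
    connection term of the Hessian. *)
Lemma raise_divergence x : U x ->
  \sum_i partial i (W i) x = metric_trace G (fun y => \matrix_(i, j)
     (partial i (w j) y - \sum_k Gam k i j y * w k y)) x
   - \sum_p (\sum_i Gam i i p x) * W p x.
Proof.
move=> Ux; rewrite /metric_trace.
have -> : \sum_i partial i (W i) x = \sum_i \sum_l
    (H x i l * partial i (w l) x + w l x * partial i (fun y => H y i l) x).
  apply: eq_bigr => i _; rewrite (partial_sum openU _ Ux); last by move=> l; exact: smoothM.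
  by apply: eq_bigr => l _; rewrite (partialM _ Ux).
have -> : \sum_p (\sum_i Gam i i p x) * W p x
   = \sum_i \sum_l w l x * (\sum_m Gam i i m x * H x m l).
  under eq_bigr do rewrite mulr_suml.
  rewrite exchange_big /=; apply: eq_bigr => i _.
  under [RHS]eq_bigr do rewrite mulr_sumr.
  rewrite [RHS]exchange_big /=; apply: eq_bigr => p _.
  by rewrite /dlog_raised /raise mulr_sumr; apply: eq_bigr => l _; ring.
rewrite -sumrB.
transitivity (\sum_i (\sum_l H x i l * partial i (w l) x
   - \sum_l w l x * (\sum_m Gam i i m x * H x m l)
   - \sum_l w l x * (\sum_m H x i m * Gam l i m x))).
  apply: eq_bigr => i _; rewrite -!sumrB; apply: eq_bigr => l _.
  by rewrite partial_inverse_metric //; ring.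
apply: eq_bigr => i _; rewrite addrAC; congr (_ - _).
under [RHS]eq_bigr do rewrite mxE mulrBr.
rewrite sumrB; congr (_ - _).
under eq_bigr do rewrite mulr_sumr.
rewrite exchange_big /=; apply: eq_bigr => m _.
by rewrite mulr_sumr; apply: eq_bigr => l _; rewrite -/(H x); ring.
Qed.

Lemma partial_dlog i j x : U x ->
  partial i (w j) x = partial i (partial j v) x / v x - w i x * w j x.
Proof.
move=> Ux; have vx := v0 Ux.
rewrite {1}/dlog (partialM _ Ux) ?(partialV _ Ux) //; last 2 first.
- exact: smooth_partial.
- exact: smoothV.
rewrite /dlog; move: (v x) vx (partial i v x) (partial j v x) (partial i _ x).
by move=> z z0 a b ab; field.
Qed.

(** The left side is the Hessian of log v, so this is the quotient rule with the connection term
    carried along. *)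
Lemma hessian_dlog i j x : U x ->
  partial i (w j) x - \sum_k Gam k i j x * w k x
  = hessian G v x i j / v x - w i x * w j x.
Proof.
move=> Ux; rewrite partial_dlog // mxE mulrBl mulr_suml.
rewrite addrAC; congr (_ - _ - _).
by apply: eq_bigr => k _; rewrite /dlog mulrA.
Qed.

Definition dlog_norm2 x := \sum_k w k x * W k x.

Lemma grad_norm2_dlog x : U x -> grad_norm2 G v x / v x ^+ 2 = dlog_norm2 x.
Proof.
move=> Ux; have vx := v0 Ux.
rewrite /grad_norm2 /metric_trace /dlog_norm2 mulr_suml; apply: eq_bigr => k _.
rewrite /dlog_raised /raise mulr_suml mulr_sumr; apply: eq_bigr => l _.
rewrite mxE /dlog -/(H x); move: (v x) vx (H x k l) (partial k v x) (partial l v x).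
by move=> z z0 h vk vl; field.
Qed.

(** The symbols change by [C], so the Ricci tensor gains the divergence of [C], minus the derivative
    of its trace, plus products. The coordinate-dependent terms cancel, and the Hessian of log v is
    then traded for that of [v]. *)
Lemma ricci_conformal x : U x ->
  ricci inverted_metric x = ricci G x + ((n%:R - 2) / v x) *: hessian G v x
    + (laplacian G v x / v x - (n%:R - 1) * (grad_norm2 G v x / v x ^+ 2)) *: G x.
Proof.
move=> Ux; have vx := v0 Ux; apply/matrixP => j k.
have chr p a b c : partial p (christoffel inverted_metric a b c) x
    = partial p (Gam a b c) x + partial p (C a b c) x.
  rewrite -(partialD _ Ux) //.
  by apply: (partial_eq openU _ _ Ux) => y Uy; exact: christoffel_conformal.
have trC : \sum_i partial j (C i i k) x = - (n%:R * partial j (w k) x).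
  rewrite -(partial_sum openU _ Ux) //.
  transitivity (partial j (fun y => - n%:R * w k y) x).
    apply: (partial_eq openU _ _ Ux) => y Uy.
    by rewrite /christoffel_diff (conf_trace _ (metricC Uy) (metric_ginv Uy)); ring.
  rewrite (partialM _ Ux) //; last exact: smooth_cst.
  by rewrite partial_cst; ring.
have divC : \sum_i partial i (C i j k) x
    = G x j k * (\sum_i partial i (W i) x)
    + \sum_i partial i (fun y => G y j k) x * W i x
    - (partial j (w k) x + partial k (w j) x).
  rewrite -(sum_split_delta (G x j k) (fun i => partial i (W i) x)
    (fun i => partial i (fun y => G y j k) x * W i x)
    (fun i => partial i (w j) x) (fun i => partial i (w k) x) j k).
  apply: eq_bigr => i _.
  have sc (b : bool) a : smooth_on U (fun y => b%:R * w a y).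
    by apply: smoothM => //; exact: smooth_cst.
  have pc (b : bool) a : partial i (fun y => b%:R * w a y) x = b%:R * partial i (w a) x.
    by rewrite (partialM _ Ux (smooth_cst openU _) (smooth_dlog a)) partial_cst mulr0 addr0.
  apply: (etrans (partialB _ Ux (smoothM openU (smG j k) (smooth_dlog_raised i))
    (smoothD openU (sc (i == k) j) (sc (i == j) k)))).
  congr (_ - _).
    by rewrite (partialM _ Ux (smG j k) (smooth_dlog_raised i)) [W i x * _]mulrC.
  apply: (etrans (partialD _ Ux (sc (i == k) j) (sc (i == j) k))).
  by congr (_ + _); exact: pc.
(* The form d log v is closed. *)
have wC : partial k (w j) x = partial j (w k) x.
  by rewrite (partial_dlog k j Ux) (partial_dlog j k Ux)
    (partialC k j openU smv Ux) [w k x * _]mulrC.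
(* These sums are not tensorial: [t] and [D] cancel against terms of the divergence, and [S] joins
   [partial j (w k)] to form the Hessian of log v. *)
pose t := \sum_p (\sum_i Gam i i p x) * W p x.
pose S := \sum_p Gam p j k x * w p x.
pose D := \sum_i (\sum_p Gam p i j x * G x p k + \sum_p Gam p i k x * G x j p) * W i x.
have Gam2 : \sum_i \sum_p (Gam i i p x * C p j k x + C i i p x * Gam p j k x
     + C i i p x * C p j k x
     - (Gam i j p x * C p i k x + C i j p x * Gam p i k x + C i j p x * C p i k x))
   = (n%:R - 2) * (w j x * w k x - S) + G x j k * (t - (n%:R - 2) * dlog_norm2 x) - D
  := conf_quadratic (w ^~ x) (metricC Ux) (metric_ginv Ux)
       (fun a b c => christoffelC a b c Ux) j k.
have expand : ricci inverted_metric x j k = ricci G x j k + \sum_i partial i (C i j k) x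
    - \sum_i partial j (C i i k) x
    + \sum_i \sum_p (Gam i i p x * C p j k x + C i i p x * Gam p j k x
     + C i i p x * C p j k x
     - (Gam i j p x * C p i k x + C i j p x * Gam p i k x + C i j p x * C p i k x)).
  rewrite [LHS]mxE [X in _ = X + _ - _ + _]mxE.
  apply: etrans (ricci_split (fun a b c => Gam a b c x) (fun a b c => C a b c x)
    (fun a b c d => partial a (Gam b c d) x) (fun a b c d => partial a (C b c d) x) j k).
  apply: eq_bigr => i _; congr (_ - _ + _); try exact: chr.
  by apply: eq_bigr => p _; congr (_ * _ - _ * _); exact: christoffel_conformal.
have divW : \sum_i partial i (W i) x
    = laplacian G v x / v x - dlog_norm2 x - t.
  apply: (etrans (raise_divergence Ux)); congr (_ - _).
  rewrite -[dlog_norm2 x](grad_norm2_dlog Ux) /laplacian /grad_norm2 /metric_trace.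
  rewrite !mulr_suml -sumrB.
  apply: eq_bigr => a _; rewrite !mulr_suml -sumrB; apply: eq_bigr => b _.
  rewrite mxE; apply: (etrans (congr1 _ (hessian_dlog a b Ux))).
  have -> : (\matrix_(i, j) (partial i v x * partial j v x)) a b
    = partial a v x * partial b v x by rewrite mxE.
  rewrite /dlog -/(H x); move: (hessian G v x a b) (v x) vx (partial a v x) (partial b v x).
  by move=> h z z0 va vb; field.
have dGW : \sum_i partial i (fun y => G y j k) x * W i x = D.
  by apply: eq_bigr => i _; congr (_ * _); exact: partial_metric.
rewrite divW dGW wC in divC.
rewrite mx_lincomb (grad_norm2_dlog Ux).
have hw := hessian_dlog j k Ux.
have -> : (n%:R - 2) / v x * hessian G v x j k
   = (n%:R - 2) * (hessian G v x j k / v x) by rewrite mulrAC mulrA.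
have {hw} -> : hessian G v x j k / v x
   = partial j (w k) x - S + w j x * w k x.
  by rewrite hw subrK.
rewrite (eq_sub4 expand divC trC Gam2).
move: (t) (S) (D) (dlog_norm2 x) (laplacian G v x / v x) (ricci G x j k) (G x j k)
  (w j x) (w k x) (partial j (w k) x) => t' S' D' N' l r g wj wk dw.
ring.
Qed.

(** * Hessian, Laplacian and gradient of 1/v for the inverted metric *)

Definition inverted_weight y : R := (v y)^-1.

Lemma smooth_inverted_weight : smooth_on U inverted_weight.
Proof. exact: smoothV. Qed.
#[local] Hint Resolve smooth_inverted_weight : core.

Lemma partial_inverted_weight k x : U x ->
  partial k inverted_weight x = - (w k x * inverted_weight x).
Proof.
move=> Ux; have vx := v0 Ux; rewrite (partialV _ Ux vx smv) /dlog /inverted_weight.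
by move: (v x) vx (partial k v x) => z z0 dz; field.
Qed.

(** Here d(1/v) = -w/v. Contracting the change of symbols with [w] gives the multiple of [G] and
    reverses the sign of the product w_i w_j, which then combines with the Hessian of log v into
    Hess v / v. *)
Lemma hessian_inversion x : U x ->
  hessian inverted_metric inverted_weight x = 0 + (- v x ^- 2) *: hessian G v x
    + (grad_norm2 G v x / v x ^+ 3) *: G x.
Proof.
move=> Ux; have vx := v0 Ux; apply/matrixP => i j.
rewrite mx_lincomb [LHS]mxE [X in _ = X + _ + _]mxE.
have d2 : partial i (partial j inverted_weight) x
    = - (partial i (w j) x * inverted_weight x) + w j x * (w i x * inverted_weight x).
  transitivity (partial i (fun y => - (w j y * inverted_weight y)) x).
    by apply: (partial_eq openU _ _ Ux) => y Uy; exact: partial_inverted_weight.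
  rewrite (partialN _ Ux (smoothM openU (smooth_dlog j) smooth_inverted_weight)).
  rewrite (partialM _ Ux (smooth_dlog j) smooth_inverted_weight).
  rewrite partial_inverted_weight //.
  by move: (inverted_weight x) (w j x) (w i x) (partial i _ x) => a b c d; ring.
have chr : \sum_k christoffel inverted_metric k i j x * partial k inverted_weight x
   = - inverted_weight x * (\sum_k Gam k i j x * w k x + \sum_k w k x * C k i j x).
  rewrite -big_split mulr_sumr /=; apply: eq_bigr => k _.
  rewrite christoffel_conformal // partial_inverted_weight //.
  by move: (inverted_weight x) (w k x) (Gam k i j x) (C k i j x) => a b c d; ring.
have Cw : \sum_k w k x * C k i j x
   = G x i j * dlog_norm2 x - (w j x * w i x + w i x * w j x)
  := conf_contract (G x) (H x) (w ^~ x) (w ^~ x) i j.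
rewrite d2 chr Cw.
have hw := hessian_dlog i j Ux.
have -> : - v x ^- 2 * hessian G v x i j
   = - inverted_weight x * (partial i (w j) x - \sum_k Gam k i j x * w k x + w i x * w j x).
  rewrite hw subrK /inverted_weight.
  by move: (v x) vx (hessian G v x i j) => z z0 h; field.
have -> : grad_norm2 G v x / v x ^+ 3 = dlog_norm2 x * inverted_weight x.
  rewrite -[dlog_norm2 x](grad_norm2_dlog Ux) /inverted_weight.
  by move: (v x) vx (grad_norm2 G v x) => z z0 h; field.
move: (inverted_weight x) (dlog_norm2 x) (\sum_k _) (w i x) (w j x)
  (partial i (w j) x) (G x i j) => a b c d e f h.
ring.
Qed.

Lemma laplacian_inversion x : U x ->
  laplacian inverted_metric inverted_weight x
  = - laplacian G v x + n%:R * (grad_norm2 G v x / v x).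
Proof.
move=> Ux; have vx := v0 Ux.
have := metric_trace_self (uG Ux) (symG Ux).
rewrite /laplacian !metric_traceE hessian_inversion // inverted_metric_inv //.
rewrite add0r linearD !linearZ /=.
rewrite -!scalemxAl mulmxDr -!scalemxAr linearZ linearD !linearZ /= -/(H x) => ->.
move: (\tr _) (grad_norm2 _ _ _) (v x) vx => l g z z0.
rewrite /GRing.scale /=.
by field.
Qed.

Lemma grad_norm2_inversion x : U x ->
  grad_norm2 inverted_metric inverted_weight x = grad_norm2 G v x / v x ^+ 2.
Proof.
move=> Ux; have vx := v0 Ux.
rewrite /grad_norm2 /metric_trace mulr_suml; apply: eq_bigr => i _.
rewrite mulr_suml; apply: eq_bigr => j _.
rewrite inverted_metric_inv // !mxE !partial_inverted_weight //.
rewrite /dlog /inverted_weight -/(H x).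
move: (H x i j) (v x) vx (partial i v x) (partial j v x) => h z z0 a b.
by field.
Qed.

End Inversion.

(** * The inversion on a manifold *)

(** A singular matrix has a nonzero row vector in its left kernel, where the quadratic form would
    vanish. *)
Lemma posdef_unitmx (R : realType) n (A : 'M[R]_n) :
  (forall w : 'rV[R]_n, w != 0 -> 0 < (w *m A *m w^T) 0 0) -> A \in unitmx.
Proof.
move=> pA; rewrite unitmxE unitfE; apply/det0P => -[w w0 wA].
by have := pA w w0; rewrite wA mul0mx mxE ltxx.
Qed.

Section Manifold.
Variables (R : realType) (n : nat) (M : smooth_manifold R n).
Implicit Types (g : tensor2 M) (u v : M -> R) (c d : chart M).

Lemma open_chart_image c : open (chart_image c).
Proof. exact: chart_image_open. Qed.

Lemma smooth_functionV v : smooth_function v -> (forall p, 0 < v p) ->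
  smooth_function (fun p => (v p)^-1).
Proof.
move=> sv v0 c; refine (smoothV (@open_chart_image c) _ (sv c)) => x _.
by rewrite /= gt_eqF.
Qed.

Lemma riemannian_unitmx g c x : riemannian_metric g -> chart_image c x ->
  g c x \in unitmx.
Proof. by case=> _ _ _ gpos Ux; apply: posdef_unitmx => w; exact: gpos. Qed.

Lemma chart_inv_transition c d x : (chart_map c @` (chart_dom c `&` chart_dom d)) x ->
  chart_inv d (transition c d x) = chart_inv c x.
Proof. by move=> [p [cp dp] <-]; rewrite /transition /= !chart_mapK. Qed.

Lemma riemannian_metric_rescale g v : riemannian_metric g ->
  smooth_function v -> (forall p, 0 < v p) ->
  riemannian_metric (fun c x => v (chart_inv c x) ^- 2 *: g c x).
Proof.
move=> [sg symg trg posg] sv v0; split.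
- move=> c i j; have oU := @open_chart_image c.
  have sV := smooth_functionV sv v0 c.
  apply: (smooth_eq oU _ (smoothM oU (smoothM oU sV sV) (sg c i j))) => x _.
  by rewrite mxE /= expr2 invfM.
- by move=> c x Ux; rewrite linearZ /= symg.
(* The conformal factor is a function on the manifold, so it takes the same value in both charts and
   factors out of the transformation law. *)
- move=> c d x Ux /=; rewrite chart_inv_transition // (trg c d) //.
  by rewrite -scalemxAr -scalemxAl.
- move=> c x w Ux w0; rewrite -scalemxAr -scalemxAl mxE mulr_gt0 //; last exact: posg.
  by rewrite invr_gt0 exprn_gt0.
Qed.

(** Tracing the quasi-Einstein equation, with tr g = n, eliminates the scalar curvature from the
    characteristic constant equation. *)
Lemma weighted_trace g v (m lambda : R) c x : riemannian_metric g -> chart_image c x ->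
  weighted_ricci (SMMS g v m%:E) c x = lambda *: g c x ->
  scalar_curvature (g c) x
  = n%:R * lambda + m / v (chart_inv c x) * laplacian (g c) (v \o chart_inv c) x.
Proof.
move=> hg Ux; have [_ symg _ _] := hg.
have := metric_trace_self (riemannian_unitmx hg Ux) (symg _ _ Ux).
rewrite /weighted_ricci /= metric_traceE => tr_g /eqP; rewrite subr_eq => /eqP E.
rewrite /laplacian /scalar_curvature !metric_traceE E linearD !linearZ /=.
rewrite mulmxDr -!scalemxAr.
by rewrite linearD !linearZ /= tr_g mulrC.
Qed.

(* The case distinction on [m = 0] in the characteristic constant disappears
   once the trace of the quasi-Einstein equation is used. *)
Lemma characteristic_constantP g v (m lambda mu : R) : riemannian_metric g ->
  (forall p, 0 < v p) -> quasi_einstein (SMMS g v m%:E) lambda ->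
  characteristic_constant (SMMS g v m%:E) lambda mu <->
  forall c x, chart_image c x -> let w := v \o chart_inv c in
    lambda * w x ^+ 2 + w x * laplacian (g c) w x + (m - 1) * grad_norm2 (g c) w x = mu.
Proof.
move=> hg v0 qe.
have equiv c x : chart_image c x -> let w := v \o chart_inv c in
    (if m == 0 then lambda * w x ^+ 2 + w x * laplacian (g c) w x 
         - grad_norm2 (g c) w x = mu
     else weighted_scalar (SMMS g v m%:E) c x + m * mu / w x ^+ 2 = (m + n%:R) * lambda) <->
    lambda * w x ^+ 2 + w x * laplacian (g c) w x + (m - 1) * grad_norm2 (g c) w x = mu.
  move=> Ux w; have w0 : w x != 0 by exact: lt0r_neq0 (v0 _).
  case: eqP => [->|/eqP m0]; first by rewrite sub0r mulN1r.
  rewrite /weighted_scalar /= (weighted_trace hg Ux (qe c x Ux)) -/w.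
  rewrite -[v (chart_inv c x)]/(w x).
  move: (laplacian _ _ _) (grad_norm2 _ _ _) (w x) w0 => l N z z0.
  (* The two equations differ by the factor -m/z^2, which is nonzero in this branch. *)
  have E : n%:R * lambda + m / z * l - 2 * m / z * l - m * (m - 1) / z ^+ 2 * N
     + m * mu / z ^+ 2 - (m + n%:R) * lambda
     = - (m / z ^+ 2) * (lambda * z ^+ 2 + z * l + (m - 1) * N - mu).
    by field.
  split.
    move/eqP; rewrite -subr_eq0 E mulf_eq0 oppr_eq0 mulf_eq0 invr_eq0 expf_eq0 /=.
    by rewrite (negbTE m0) (negbTE z0) /= subr_eq0 => /eqP.
  by move=> F; apply/eqP; rewrite -subr_eq0 E F subrr mulr0.
by split=> h c x Ux; apply/(equiv c x Ux); exact: h.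
Qed.

Lemma quasi_einstein_inversion g v (m lambda mu : R) :
  quasi_einstein_smms (SMMS g v m%:E) lambda mu ->
  quasi_einstein_smms (SMMS (fun c x => v (chart_inv c x) ^- 2 *: g c x)
    (fun p => (v p)^-1) (2 - m - n%:R)%:E) mu lambda.
Proof.
move=> [[/= hg [sv /(_ isT) v0]] qe cc].
have vV0 p : 0 < (v p)^-1 by rewrite invr_gt0.
have hgt := riemannian_metric_rescale hg sv v0.
have {cc} cc := (characteristic_constantP mu hg v0 qe).1 cc.
have [sg symg _ _] := hg.
have uG c x : chart_image c x -> g c x \in unitmx by exact: riemannian_unitmx.
have vn0 c x : chart_image c x -> (v \o chart_inv c) x != 0 by rewrite /= gt_eqF.
have qet : quasi_einstein (SMMS (fun c x => v (chart_inv c x) ^- 2 *: g c x)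
    (fun p => (v p)^-1) (2 - m - n%:R)%:E) mu.
  move=> c x Ux; have oU := @open_chart_image c.
  have Er := ricci_conformal oU (sg c) (symg c) (uG c) (sv c) (vn0 c) Ux.
  have Eh := hessian_inversion oU (sg c) (symg c) (uG c) (sv c) (vn0 c) Ux.
  have := qe c x Ux; have := cc c x Ux.
  rewrite /weighted_ricci /= => E /eqP; rewrite subr_eq => /eqP Eric.
  rewrite -[ricci _ x]/(ricci (inverted_metric (g c) (v \o chart_inv c)) x).
  rewrite -[hessian _ _ x]/(hessian (inverted_metric (g c) (v \o chart_inv c))
    (inverted_weight (v \o chart_inv c)) x).
  (* [Eric] eliminates the Ricci tensor and [-E] replaces [mu] by its expression in [v], so a
     rational identity remains in each matrix entry. *)
  rewrite Er Eh Eric -E -[(v \o _) x]/(v (chart_inv c x)).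
  have := vn0 c x Ux; rewrite /=.
  move: (laplacian _ _ _) (grad_norm2 _ _ _) (v _) (hessian _ _ _) (g c x)
    => l N z h G z0.
  by apply/matrixP => i j; rewrite !mxE; field.
split => //.
  by split => //; split => //; exact: smooth_functionV.
(* The new parameter 2 - m - n may be 0; the uniform form of the characteristic identity covers that
   case too. *)
apply/(characteristic_constantP _ hgt vV0 qet) => c x Ux w; have oU := @open_chart_image c.
have El := laplacian_inversion oU (sg c) (symg c) (uG c) (sv c) (vn0 c) Ux.
have En := grad_norm2_inversion (uG c) (sv c) (vn0 c) Ux.
rewrite -[laplacian _ _ x]/(laplacian (inverted_metric (g c) (v \o chart_inv c))
    (inverted_weight (v \o chart_inv c)) x).
rewrite -[grad_norm2 _ _ x]/(grad_norm2 (inverted_metric (g c) (v \o chart_inv c))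
    (inverted_weight (v \o chart_inv c)) x).
rewrite El En -(cc c x Ux) /w /=.
have := vn0 c x Ux; rewrite /=.
move: (laplacian _ _ _) (grad_norm2 _ _ _) (v _) => l N z z0.
by field.
Qed.

(** The inversion is applied to the weight v/u over u^-2 g: the factors of [u] cancel in the metric,
    and the weight becomes u/v. *)
Lemma quasi_einstein_exchange g u v (m lambda mu : R) :
  (forall p, 0 < u p) -> (forall p, 0 < v p) ->
  quasi_einstein_smms (SMMS (fun c x => u (chart_inv c x) ^- 2 *: g c x)
    (fun p => v p / u p) m%:E) lambda mu ->
  quasi_einstein_smms (SMMS (fun c x => v (chart_inv c x) ^- 2 *: g c x)
    (fun p => u p / v p) (2 - m - n%:R)%:E) mu lambda.
Proof.
move=> u0 v0 /quasi_einstein_inversion.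
have -> : (fun (c : chart M) x => (v (chart_inv c x) / u (chart_inv c x)) ^- 2
    *: (u (chart_inv c x) ^- 2 *: g c x)) = (fun c x => v (chart_inv c x) ^- 2 *: g c x).
  apply/funext => c; apply/funext => x; rewrite scalerA; congr (_ *: _).
  have := lt0r_neq0 (u0 (chart_inv c x)); have := lt0r_neq0 (v0 (chart_inv c x)).
  by move: (u _) (v _) => a b a0 b0; field; rewrite a0.
by under [X in SMMS _ X _]eq_fun do rewrite invf_div.
Qed.

(** The weighted formulas are the same for both infinities, and the characteristic condition there
    forces [mu = lambda], so the constants can be exchanged. Both signs must be allowed, since 2 - m
    - n has the sign opposite to m. *)
Lemma quasi_einstein_infinite g v (m m' : \bar R) (lambda mu : R) :
  m \isn't a fin_num -> m' \isn't a fin_num ->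
  quasi_einstein_smms (SMMS g v m) lambda mu ->
  quasi_einstein_smms (SMMS g v m') mu lambda.
Proof. by case: m => // _; case: m' => // _ [[hg [sv _]] qe /= ->]; split. Qed.

End Manifold.

Theorem corollary4p16 (R : realType) (n : nat) (M : smooth_manifold R n)
    (g : tensor2 M) (hg : riemannian_metric g) (m : \bar R) (u v : M -> R)
    (hu : weight_function m u) (hv : weight_function m v) (lambda mu : R) :
  let m' := (2%:E - m - n%:R%:E)%E in
  let ghat := rescaled_metric m u g in
  let vhat := rescaled_weight m u v in
  let gtilde := rescaled_metric m v g in
  let utilde := rescaled_weight m v u in
  [<-> is_smms (SMMS g v m) /\
         quasi_einstein_scale (SMMS g v m) mu u lambda;
       quasi_einstein_smms (SMMS ghat vhat m) lambda mu;
       is_smms (SMMS g u m') /\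
         quasi_einstein_scale (SMMS g u m') lambda v mu;
       quasi_einstein_smms (SMMS gtilde utilde m') mu lambda ].
Proof.
case: m hu hv => [m||] hu hv m' ghat vhat gtilde utilde.
- have [su /(_ isT) u0] := hu; have [sv /(_ isT) v0] := hv.
  tfae.
  + by case=> _ [].
  + by move/(quasi_einstein_exchange u0 v0).
  + by case=> _ [].
  (* The exchange with [u] and [v] swapped returns the parameter 2 - (2 - m - n) - n, which is m. *)
  + move/(quasi_einstein_exchange v0 u0) => h; split => //; split => //.
    by have <- : 2 - (2 - m - n%:R) - n%:R = m by ring.
(* For infinite m both rescalings fix the metric and add the two functions, so the hat and tilde
   data agree up to the order of the sum. *)
all: have wC : vhat = utilde by apply/funext => p; exact: addrC.
all: tfae; [by case=> _ [] | | by case=> _ [] |].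
all: rewrite ?wC => /quasi_einstein_infinite h; split => //; split => //.
all: by [apply: h | rewrite -wC in h; apply: h].
Qed.
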